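(* Let $(X,d,T)$ be a topological dynamical system and $\mu\in M(X,T)$. Then the following statements are equivalent: (1) $\mu\times\mu(\{(x,y)\in X\times X:d_{FK}(x,y)=0\})=1$. (2) There exists $M\subset X$ with $\mu(M)=1$ such that $d_{FK}(x,y)=0$ for all $x,y\in M$. (3) For every finite partition $\mathcal{P}$ of $X$ and every $\epsilon>0$, there exists $N$ such that for every $n>N$ there exists a word $w\in\mathcal{P}^n$ such that $\mu(\{w'\in\mathcal{P}^n:\bar f_n(w,w')<\epsilon\})\ge1-\epsilon$. Moreover, any one of (1), (2), (3) implies the ergodicity of $\mu$.
   Context: A topological dynamical system $(X,d,T)$ consists of a compact metric space $X$ with metric $d$ and a continuous map $T:X\to X$. $M(X,T)$ is the set of all $T$-invariant Borel probability measures on $X$. For $x,y\in X$, $\delta>0$ and $n\in\mathbb{N}$, an $(n,\delta)$-match of $x$ and $y$ is an order preserving bijection $\pi:D(\pi)\to R(\pi)$ (i.e. $\pi(i)<\pi(j)$ whenever $i<j$) with $D(\pi),R(\pi)\subset\{0,1,\ldots,n-1\}$ such that $d(T^ix,T^{\pi(i)}y)<\delta$ for every $i\in D(\pi)$. Let $|\pi|$ be the cardinality of $D(\pi)$. Set $$\bar f_{n,\delta}(x,y)=1-\frac{\max\{|\pi|:\pi\text{ is an }(n,\delta)\text{-match of }x\text{ and }y\}}{n},\qquad \bar f_\delta(x,y)=\limsup_{n\to+\infty}\bar f_{n,\delta}(x,y),$$ $$d_{FK}(x,y)=\inf\{\delta>0:\bar f_\delta(x,y)<\delta\}.$$ Partitions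 are measurable. For a finite partition $\mathcal{P}=\{A_1,\ldots,A_k\}$ of $X$, $\mathcal{P}^n=\bigvee_{i=0}^{n-1}T^{-i}\mathcal{P}$, whose elements are identified with words in $\{1,\ldots,k\}^n$ via $\bigcap_{i=0}^{n-1}T^{-i}A_{t_i}=(t_0,\ldots,t_{n-1})$; the measure of a set of words is the $\mu$-measure of the union of the corresponding elements of $\mathcal{P}^n$. The edit distance between two words of length $n$ is $$\bar f_n(x_0x_1\ldots x_{n-1},y_0y_1\ldots y_{n-1})=1-\frac kn,$$ where here $k$ is the largest integer such that there exist $0\le i_1<\cdots<i_k\le n-1$ and $0\le j_1<\cdots<j_k\le n-1$ with $x_{i_s}=y_{j_s}$ for $s=1,\ldots,k$. *)

(* Defs.v *)
From HB Require Import structures.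
From mathcomp Require Import all_boot all_order all_algebra.
From mathcomp Require Import all_classical all_reals all_analysis.

Set Implicit Arguments.
Unset Strict Implicit.
Unset Printing Implicit Defensive.

Import Order.TTheory GRing.Theory Num.Theory.
Import numFieldNormedType.Exports.

Local Open Scope classical_set_scope.
Local Open Scope ring_scope.

(* Measurable types are pointed in the library whereas metric ones are not; a
   space carrying a probability measure is nonempty, so nothing is lost. *)
#[short(type="pointedMetricType")]
HB.structure Definition PointedMetric (R : numDomainType) :=
  {X of Pointed X & Metric R X}.

Definition borel (R : realType) (X : pointedMetricType R) :=
  g_sigma_algebraType (@open X).

(* The measurable sets of [borel X * borel X] form the product sigma-algebra,
   which for compact [X] is the Borel sigma-algebra of the product. *)

Definition invariant_measure (R : realType) (X : pointedMetricType R)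
    (T : X -> X) (mu : probability (borel X) R) : Prop :=
  forall A : set (borel X), measurable A -> mu (T @^-1` A) = mu A.

Definition ergodic_measure (R : realType) (X : pointedMetricType R)
    (T : X -> X) (mu : probability (borel X) R) : Prop :=
  forall A : set (borel X), measurable A -> T @^-1` A = A ->
    mu A = 0%E \/ mu A = 1%E.

(* A match pi : D(pi) -> R(pi) is represented by D(pi) and a total function
   extending it, R(pi) being the image of D(pi); strict monotonicity on D(pi)
   makes it a bijection onto R(pi). *)
Definition is_match (R : realType) (X : metricType R) (T : X -> X)
    (n : nat) (delta : R) (x y : X)
    (D : {set 'I_n}) (pi : {ffun 'I_n -> 'I_n}) : bool :=
  [forall i in D, forall j in D, (i < j)%N ==> (pi i < pi j)%N] &&
  [forall i in D, mdist (iter i T x) (iter (pi i) T y) < delta].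

Definition max_match (R : realType) (X : metricType R) (T : X -> X)
    (n : nat) (delta : R) (x y : X) : nat :=
  \max_(m : {set 'I_n} * {ffun 'I_n -> 'I_n}
        | is_match T delta x y m.1 m.2) #|m.1|.

Definition fbar_match (R : realType) (X : metricType R) (T : X -> X)
    (delta : R) (x y : X) (n : nat) : R :=
  1 - (max_match T n delta x y)%:R / n%:R.

(* The sequence takes its values in [0, 1], so the real-valued limsup is the
   genuine one. *)
Definition fbar_lim (R : realType) (X : metricType R) (T : X -> X)
    (delta : R) (x y : X) : R :=
  limn_sup (fbar_match T delta x y).

(* Every delta > 1 belongs to the set, so the infimum is over a nonempty set
   bounded below. *)
Definition dFK (R : realType) (X : metricType R) (T : X -> X) (x y : X) : R :=
  inf [set delta : R | 0 < delta /\ fbar_lim T delta x y < delta].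

(* The bound m <= n on the length of a common subsequence is automatic, since
   the index sequences are strictly increasing in 'I_n. *)
Definition common_subseq (k n : nat) (x y : n.-tuple 'I_k) (m : nat) : bool :=
  [exists i : {ffun 'I_m -> 'I_n}, [exists j : {ffun 'I_m -> 'I_n},
    [&& [forall s : 'I_m, forall t : 'I_m, (s < t)%N ==> (i s < i t)%N],
        [forall s : 'I_m, forall t : 'I_m, (s < t)%N ==> (j s < j t)%N] &
        [forall s : 'I_m, tnth x (i s) == tnth y (j s)]]]].

Definition edit_dist (R : realType) (k n : nat) (x y : n.-tuple 'I_k) : R :=
  1 - (\max_(m < n.+1 | common_subseq x y m) m)%:R / n%:R.

Definition measurable_partition (R : realType) (X : pointedMetricType R)
    (k : nat) (P : 'I_k -> set (borel X)) : Prop :=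
  partition [set: 'I_k] P [set: borel X] /\ forall i, measurable (P i).

Definition cell (X : Type) (T : X -> X) (k : nat) (P : 'I_k -> set X)
    (n : nat) (w : n.-tuple 'I_k) : set X :=
  \bigcap_(i in [set: 'I_n]) (iter i T @^-1` P (tnth w i)).

(* The elements of the n-th join are its nonempty cells. *)
Definition join_words (X : Type) (T : X -> X) (k : nat) (P : 'I_k -> set X)
    (n : nat) : set (n.-tuple 'I_k) :=
  [set w | cell T P w !=set0].

(* Main.v *)
Require Import Defs.
From HB Require Import structures.
From mathcomp Require Import all_boot all_order all_algebra.
From mathcomp Require Import all_classical all_reals all_analysis.
From mathcomp Require Import measurable_realfun.
From mathcomp Require Import zify lra.

Set Implicit Arguments.
Unset Strict Implicit.
Unset Printing Implicit Defensive.

Import Order.TTheory GRing.Theory Num.Theory.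
Import numFieldNormedType.Exports.

Local Open Scope classical_set_scope.
Local Open Scope ring_scope.

(** Write [x ~ y] for [dFK T x y = 0]. Since a match for a threshold is a match
    for every larger one, [x ~ y] means that for each [e > 0] the orbits of [x]
    and [y] have, for all large [n], a match at threshold [e] that misses at most
    a proportion [e] of the first [n] times (lemma [dFK0P]). Matches can be
    reversed and composed, so [~] is an equivalence relation.

    If almost every pair is equivalent, then by Tonelli some point is equivalent
    to almost every point, and its class has full measure; conversely a class of
    full measure gives a square of full measure in the product.

    Suppose that a class has full measure and fix a reference point in it. Most
    points have, from some common time on, a good match with the reference
    orbit, hence with each other. The cells of a partition are Borel sets, so
    two close points lie in the same cell unless one of them belongs to a small
    bad set [nearly_continuous_measurable]. By a maximal inequality most orbits
    visit this bad set with small frequency at all times; deleting the visits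
    turns a match of orbits into a common subsequence of names
    [full_set_short_words].

    Conversely, suppose that the names of some length [n] concentrate near one
    word [w], for a partition into cells of small diameter. The maximal
    inequality, applied to the complement of the set of good names, shows that
    outside a small set every orbit is filled, up to a small proportion of any
    long time interval that begins at [0], by disjoint blocks of length [n] with
    names close to [w].
    Matching the blocks of two such orbits in order of appearance shows that
    these orbits stay close at all large times [short_words_scale]. The small
    sets are summable along a sequence of scales, and by Borel-Cantelli almost
    every point lies in none of them from some scale on. The maximal inequality
    replaces the ergodic theorem: it holds for every invariant measure and
    controls all the time intervals that begin at [0] at once.

    Ergodicity is read off from the partition into an invariant set and its
    complement: its names are constant words, and a word cannot be close in
    the edit distance to both of them. *)

(** * Order-preserving matches as lists of pairs *)

Definition pair_lt (p q : nat * nat) : bool := ((p.1 < q.1) && (p.2 < q.2))%N.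

(** Matches are kept as increasing lists of pairs: composition, deletion and
    concatenation of matches are then map, filter and append. *)
Definition matching (r : rel nat) (n : nat) (s : seq (nat * nat)) : bool :=
  pairwise pair_lt s &&
  all (fun p => [&& (p.1 < n)%N, (p.2 < n)%N & r p.1 p.2]) s.

Definition matchable (r : rel nat) (n k : nat) : Prop :=
  exists2 s, matching r n s & (k <= size s)%N.

Lemma leq_matchable (r : rel nat) n k k' :
  (k <= k')%N -> matchable r n k' -> matchable r n k.
Proof. by move=> kk' [s ms k's]; exists s => //; exact: leq_trans k's. Qed.

Lemma sub_matchable (r r' : rel nat) n k :
  (forall i j, (i < n)%N -> (j < n)%N -> r i j -> r' i j) ->
  matchable r n k -> matchable r' n k.
Proof.
move=> rr' [s /andP[ps /allP as_] ks]; exists s => //.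
apply/andP; split=> //; apply/allP => p /as_ /and3P[pn qn rp].
by rewrite pn qn rr'.
Qed.

Lemma matching_comparable s p q : pairwise pair_lt s -> p \in s -> q \in s ->
  [\/ p = q, pair_lt p q | pair_lt q p].
Proof.
move=> /(pairwiseP (0, 0)%N) ps pins qins.
rewrite -(nth_index (0, 0)%N pins) -(nth_index (0, 0)%N qins).
have ip : (index p s < size s)%N by rewrite index_mem.
have iq : (index q s < size s)%N by rewrite index_mem.
case: (ltngtP (index p s) (index q s)) => [h|h|->].
- by constructor 2; apply: ps.
- by constructor 3; apply: ps.
- by constructor 1.
Qed.

Lemma matching_uniq1 s : pairwise pair_lt s -> uniq (unzip1 s).
Proof.
move=> ps; have : pairwise ltn (unzip1 s).
  by rewrite pairwise_map; apply: sub_pairwise ps => p q /andP[].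
by move=> h; apply: (pairwise_uniq _ h) => x /=; rewrite ltnn.
Qed.

Lemma matching_uniq2 s : pairwise pair_lt s -> uniq (unzip2 s).
Proof.
move=> ps; have : pairwise ltn (unzip2 s).
  by rewrite pairwise_map; apply: sub_pairwise ps => p q /andP[].
by move=> h; apply: (pairwise_uniq _ h) => x /=; rewrite ltnn.
Qed.

Definition swap_pair (p : nat * nat) := (p.2, p.1).

Lemma matchable_sym (r r' : rel nat) n k : (forall i j, r i j -> r' j i) ->
  matchable r n k -> matchable r' n k.
Proof.
move=> rr' [s /andP[ps /allP as_] ks]; exists (map swap_pair s).
  apply/andP; split.
    by rewrite pairwise_map; apply: sub_pairwise ps => p q /andP[]/=;
       rewrite /pair_lt/= => -> ->.
  by apply/allP => _ /mapP[p /as_/and3P[pn qn rp] ->]/=; rewrite pn qn rr'.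
by rewrite size_map.
Qed.

Lemma uniq_ltn_size (n : nat) (s : seq nat) :
  uniq s -> all (fun i => i < n)%N s -> (size s <= n)%N.
Proof.
move=> us /allP sn; rewrite -[leqRHS](size_iota 0).
by apply: uniq_leq_size => // i /sn; rewrite mem_iota.
Qed.

Lemma matchable_size (r : rel nat) n k : matchable r n k -> (k <= n)%N.
Proof.
move=> [s /andP[ps as_] ks]; apply: (leq_trans ks).
rewrite -(size_map fst); apply: uniq_ltn_size (matching_uniq1 ps) _.
by rewrite all_map; apply: sub_all as_ => p /and3P[].
Qed.

Definition partner (s : seq (nat * nat)) (j : nat) : nat :=
  nth 0%N (unzip2 s) (index j (unzip1 s)).

Lemma partner_mem s j : j \in unzip1 s -> (j, partner s j) \in s.
Proof.
move=> js; have ij : (index j (unzip1 s) < size s)%N.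
  by rewrite -(size_map fst) index_mem.
have -> : (j, partner s j) = nth (0, 0)%N s (index j (unzip1 s)).
  rewrite /partner (nth_map (0, 0)%N)//.
  rewrite -{1}(nth_index 0%N js) (nth_map (0, 0)%N)//.
  by case: nth.
exact: mem_nth.
Qed.

(** Two matches through a common middle word of length [n] compose on the
    middle positions used by both, and at most [n - k1 + (n - k2)] positions
    are missed. *)
Lemma matchable_comp (r1 r2 r : rel nat) n k1 k2 :
  (forall i j l, r1 i j -> r2 j l -> r i l) ->
  matchable r1 n k1 -> matchable r2 n k2 -> matchable r n (k1 + k2 - n).
Proof.
move=> r12 [s1 /andP[ps1 as1] ks1] [s2 /andP[ps2 as2] ks2].
pose both := fun p : nat * nat => p.2 \in unzip1 s2.
exists [seq (p.1, partner s2 p.2) | p <- [seq p <- s1 | both p]].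
  apply/andP; split.
    rewrite pairwise_map.
    have : pairwise pair_lt ([seq p <- s1 | both p]) by exact: pairwise_filter.
    apply: (@sub_in_pairwise _ both); last exact: filter_all.
    move=> p q pb qb /andP[pq1 pq2]; rewrite /relpre/pair_lt/= pq1/=.
    case: (matching_comparable ps2 (partner_mem pb) (partner_mem qb)).
    - by case=> pq; move: pq2; rewrite pq ltnn.
    - by case/andP.
    - by case/andP => /= h; move: (ltn_trans h pq2); rewrite ltnn.
  apply/allP => pq /mapP[p]; rewrite mem_filter => /andP[pb ps] ->/=.
  have /and3P[-> pn rp] := allP as1 _ ps.
  have /and3P[/= _ -> rq] := allP as2 _ (partner_mem pb).
  exact: r12 rp rq.
rewrite size_map size_filter.
have cs1 := count_predC both s1.
have : (size [seq p <- s1 | predC both p] + size s2 <= n)%N.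
  rewrite -(size_map snd) -[X in (_ + X)%N](size_map fst) -size_cat.
  apply: uniq_ltn_size.
    rewrite cat_uniq (matching_uniq1 ps2) andbT matching_uniq2/=; last first.
      exact: pairwise_filter.
    apply/hasPn => j js2; apply/negP => /mapP[p].
    by rewrite mem_filter /= /both => /andP[+ _] pj; rewrite -pj js2.
  rewrite all_cat !all_map; apply/andP; split.
    by rewrite all_filter; apply: sub_all as1 => p /and3P[_ h _]; apply/implyP.
  by apply: sub_all as2 => p /and3P[].
rewrite size_filter => h; move: cs1 ks1 ks2 h.
move: (count _ _) (count _ _) (size s1) (size s2) => a b c d.
lia.
Qed.

(** Each deleted index destroys at most one pair of a match. *)
Lemma matchable_restrict (r : rel nat) (b1 b2 : pred nat) n k :
  matchable r n k ->
  matchable (fun i j => [&& r i j, ~~ b1 i & ~~ b2 j]) n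
    (k - (\sum_(0 <= i < n) b1 i + \sum_(0 <= i < n) b2 i)).
Proof.
move=> [s /andP[ps as_] ks].
pose ok := fun p : nat * nat => ~~ b1 p.1 && ~~ b2 p.2.
exists ([seq p <- s | ok p]).
  apply/andP; split; first exact: pairwise_filter.
  apply/allP => p; rewrite mem_filter => /andP[/andP[p1 p2] ps'].
  by have /and3P[-> -> ->] := allP as_ _ ps'; rewrite p1 p2.
have bound (b : pred nat) (u : seq nat) : uniq u ->
    all (fun i => i < n)%N u -> (count b u <= \sum_(0 <= i < n) b i)%N.
  move=> uu un.
  have -> : (\sum_(0 <= i < n) b i = count b (iota 0 n))%N.
    rewrite -sum1_count [RHS]big_mkcond /= /index_iota subn0.
    by apply: eq_bigr => i _; case: (b i).
  rewrite -!size_filter; apply: uniq_leq_size; first exact: filter_uniq.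
  move=> i; rewrite !mem_filter mem_iota => /andP[-> iu] /=.
  exact: (allP un).
have := count_predC ok s; rewrite size_filter.
have : (count (predC ok) s <= count b1 (unzip1 s) + count b2 (unzip2 s))%N.
  rewrite !count_map -count_predUI; apply: leq_trans (leq_addr _ _).
  by apply: sub_count => p /=; rewrite /ok negb_and !negbK.
have := bound b1 (unzip1 s) (matching_uniq1 ps).
rewrite all_map (sub_all _ as_) => [/(_ isT)|p /and3P[]//].
have := bound b2 (unzip2 s) (matching_uniq2 ps).
rewrite all_map (sub_all _ as_) => [/(_ isT)|p /and3P[]//].
have -> : count [eta ok] s = count ok s by [].
move: ks; move: (size s) (count b1 _) (count b2 _) (count _ s) (count _ s).
lia.
Qed.

(** * Greedy packing of blocks *)

(** Disjoint blocks of length [n] inside the interval from [a] to [L], recorded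
    by their starting points in increasing order, so that matches of successive
    blocks can be concatenated. *)
Fixpoint packing (g : pred nat) (n L a : nat) (t : seq nat) : bool :=
  if t is i :: t' then
    [&& (a <= i)%N, (i + n <= L)%N, g i & packing g n L (i + n) t']
  else true.

(** The greedy packing takes every good position it meets; the positions it
    leaves uncovered are bad, apart from the last [n]. *)
Lemma packing_exists (g : pred nat) n L : (0 < n)%N -> forall m a,
  (a + m = L)%N ->
  exists2 t, packing g n L a t &
    (m <= size t * n + \sum_(a <= i < L) ~~ g i + n)%N.
Proof.
move=> n0; elim/ltn_ind => m IH a amL.
have [mn|nm] := leqP m n; first by exists [::] => //; lia.
have aL : (a < L)%N by lia.
have [ga|ga] := boolP (g a).
  have [||t pt mt] := IH (m - n)%N _ (a + n)%N; [lia|lia|].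
  exists (a :: t); first by rewrite /= leqnn ga pt andbT/= andbT; lia.
  rewrite /= (@big_cat_nat _ _ _ (a + n))/=; [|lia|lia].
  move: mt; rewrite mulSn; lia.
have [||t pt mt] := IH m.-1 _ a.+1; [lia|lia|].
exists t.
  by case: t pt {mt} => //= i t /and4P[ai -> -> ->]; rewrite (ltnW ai).
by rewrite big_ltn// ga; lia.
Qed.

(** Blocks are paired in order of appearance, whatever their positions: a match
    allows arbitrary delays, and the concatenation of matches of successive
    blocks is still increasing. *)
Lemma matchable_packing (r : rel nat) (g1 g2 : pred nat) n q L :
  (forall i j, g1 i -> g2 j -> matchable (fun u v => r (i + u)%N (j + v)%N) n q) ->
  forall t1 t2, packing g1 n L 0 t1 -> packing g2 n L 0 t2 ->
  matchable r L (minn (size t1) (size t2) * q).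
Proof.
move=> h; have key t1 : forall t2 a b, packing g1 n L a t1 ->
    packing g2 n L b t2 ->
    exists2 s, matching r L s && all (fun p => (a <= p.1) && (b <= p.2))%N s &
      (minn (size t1) (size t2) * q <= size s)%N.
  elim: t1 => [|i t1 IH] [|j t2] a b; try by exists [::]; rewrite //= ?minn0.
  move=> /= /and4P[ai iL gi p1] /and4P[bj jL gj p2].
  have [s /andP[/andP[ps /allP as_] /allP bs] sz] := IH _ _ _ p1 p2.
  have [s0 /andP[ps0 /allP as0] sz0] := h _ _ gi gj.
  pose sh := fun p : nat * nat => ((i + p.1)%N, (j + p.2)%N).
  exists (map sh s0 ++ s); last by rewrite size_cat size_map minnSS mulSn leq_add.
  apply/andP; split; [apply/andP; split|].
  - rewrite pairwise_cat ps andbT pairwise_map; apply/andP; split.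
      apply/allrelP => _ p' /mapP[p ps0' ->] /bs/andP[p1' p2'].
      have /and3P[pn1 pn2 _] := as0 _ ps0'.
      by rewrite /pair_lt/=; lia.
    apply: sub_pairwise ps0 => p p'; rewrite /relpre /pair_lt /=; lia.
  - rewrite all_cat; apply/andP; split; last exact/allP.
    apply/allP => _ /mapP[p /as0 /and3P[pn1 pn2 rp] ->] /=.
    by rewrite rp andbT; lia.
  - rewrite all_cat; apply/andP; split.
      by apply/allP => _ /mapP[p _ ->] /=; lia.
    by apply/allP => p /bs; lia.
move=> t1 t2 p1 p2; have [s /andP[ms _] sz] := key _ _ _ _ p1 p2.
by exists s.
Qed.

(** A Vitali covering argument on the integers: windows chosen greedily from
    left to right are disjoint and contain every marked position, so the marked
    positions are at most as numerous as the total length of the windows. *)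
Lemma density_covering (R : realType) (c : R) (e b : pred nat) (K : nat) :
  0 <= c ->
  (forall i, e i -> exists N, [/\ (0 < N)%N, (N <= K)%N &
     c * N%:R <= (\sum_(i <= j < i + N) b j)%:R]) ->
  forall m a, c * (\sum_(a <= i < a + m) e i)%:R
    <= (\sum_(a <= i < a + m + K) b i)%:R.
Proof.
move=> c0 h; elim/ltn_ind => m IH a.
have cat_b x y z : (x <= y)%N -> (y <= z)%N ->
    (\sum_(x <= i < z) b i = \sum_(x <= i < y) b i + \sum_(y <= i < z) b i)%N.
  by move=> xy yz; rewrite (@big_cat_nat _ _ _ y).
case: m IH => [|m] IH; first by rewrite addn0 big_geq// mulr0 ler0n.
have [ea|ea] := boolP (e a); last first.
  rewrite big_ltn ?(negbTE ea) ?add0n; last by lia.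
  have := IH m (ltnSn m) a.+1; rewrite addSnnS => /le_trans; apply.
  by rewrite ler_nat (cat_b a a.+1) ?leq_addl//; lia.
have [N [N0 NK bN]] := h _ ea.
(* A window that sticks out of the range fits in the extra length [K]. *)
have [mN|Nm] := leqP m.+1 N.
  apply: (@le_trans _ _ (c * N%:R)).
    rewrite ler_wpM2l// ler_nat (leq_trans _ mN)//.
    rewrite -[leqRHS](_ : (\sum_(a <= i < a + m.+1) 1)%N = _)%N; last first.
      by rewrite sum_nat_const_nat; lia.
    by apply: leq_sum => i _; case: (e i).
  have cb : (a + N <= a + m.+1 + K)%N by lia.
  by rewrite (le_trans bN)// ler_nat (cat_b _ _ _ (leq_addr N a) cb) leq_addr.
rewrite (@big_cat_nat _ _ _ (a + N))/=; [|lia|lia].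
rewrite (cat_b a (a + N)%N); [|lia|lia].
rewrite !natrD mulrDr lerD//.
  apply: le_trans bN; rewrite ler_wpM2l// ler_nat.
  rewrite -[leqRHS](_ : (\sum_(a <= i < a + N) 1)%N = _)%N; last first.
    by rewrite sum_nat_const_nat; lia.
  by apply: leq_sum => i _; case: (e i).
have := IH (m.+1 - N)%N _ (a + N)%N.
by rewrite -addnA subnKC; [apply; lia|lia].
Qed.

(** * The two distances in terms of matches *)

Definition orbit_rel (R : realType) (X : metricType R) (T : X -> X) (delta : R)
    (x y : X) : rel nat :=
  fun i j => mdist (iter i T x) (iter j T y) < delta.

(** Letters are compared as numbers, so that positions can be plain naturals;
    the default [0] is never read inside a match, whose positions are in range. *)
Definition word_rel (k n : nat) (x y : n.-tuple 'I_k) : rel nat :=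
  fun i j => nth 0%N (map val x) i == nth 0%N (map val y) j.

Lemma word_relE k n (x y : n.-tuple 'I_k) (i j : 'I_n) :
  word_rel x y i j = (tnth x i == tnth y j).
Proof.
rewrite /word_rel (nth_map (tnth x i)) ?size_tuple//.
rewrite (nth_map (tnth x i)) ?size_tuple//.
by rewrite -!tnth_nth val_eqE.
Qed.

Lemma matchable0 r n : matchable r n 0.
Proof. by exists [::]. Qed.

Lemma matchable_maxn r n k1 k2 :
  matchable r n k1 -> matchable r n k2 -> matchable r n (maxn k1 k2).
Proof. by rewrite /maxn; case: ifP. Qed.

Lemma pairwise_enum_ord n : pairwise (fun i j : 'I_n => (i < j)%N) (enum 'I_n).
Proof.
have : pairwise ltn (map val (enum 'I_n)).
  by rewrite val_enum_ord -(sorted_pairwise ltn_trans) iota_ltn_sorted.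
by rewrite pairwise_map.
Qed.

Lemma max_matchP (R : realType) (X : metricType R) (T : X -> X) (delta : R)
    (x y : X) n k :
  (k <= max_match T n delta x y)%N <-> matchable (orbit_rel T delta x y) n k.
Proof.
split=> [kmax|].
  apply: leq_matchable kmax _; rewrite /max_match.
  elim/big_ind: _ => [||[D pi] /= /andP[/'forall_implyP mono /'forall_implyP near]].
  - exact: matchable0.
  - by move=> a b; exact: matchable_maxn.
  exists [seq (val i, val (pi i)) | i <- enum D]; last by rewrite size_map cardE.
  apply/andP; split; last first.
    apply/allP => z /mapP[i]; rewrite mem_enum => iD -> /=.
    by rewrite !ltn_ord; apply: near.
  rewrite pairwise_map.
  apply: (@sub_in_pairwise _ (mem D) (fun i j : 'I_n => (i < j)%N)).
  - move=> i j iD jD ij; rewrite /relpre /pair_lt /= ij /=.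
    by move: (mono _ iD) => /'forall_implyP/(_ _ jD)/implyP; apply.
  - by apply/allP => i; rewrite mem_enum.
  - have -> : enum D = [seq i <- enum 'I_n | i \in D] by rewrite [in RHS]enumT.
    exact: pairwise_filter (pairwise_enum_ord n).
case=> s /andP[ps /allP as_] ks; apply: (leq_trans ks).
pose D := [set i : 'I_n | val i \in unzip1 s]%SET.
(* Off the domain of the match [insubd] supplies an arbitrary index. *)
pose pi := [ffun i : 'I_n => insubd i (partner s i)].
have piE i : i \in D -> val (pi i) = partner s i.
  rewrite inE => /partner_mem /as_ /and3P[_ pn _].
  by rewrite ffunE val_insubd pn.
have mDpi : is_match T delta x y D pi.
  apply/andP; split.
    apply/'forall_implyP => i iD; apply/'forall_implyP => j jD; apply/implyP => ij.
    rewrite !piE//; move: iD jD; rewrite !inE => iD jD.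
    case: (matching_comparable ps (partner_mem iD) (partner_mem jD)).
    - by case=> ji; move: ij; rewrite ji ltnn.
    - by case/andP.
    - by case/andP => /= h; move: (ltn_trans h ij); rewrite ltnn.
  apply/'forall_implyP => i iD; rewrite piE//.
  by move: iD; rewrite inE => /partner_mem /as_ /and3P[].
have := @leq_bigmax_cond _ (fun m => is_match T delta x y m.1 m.2)
  (fun m : {set 'I_n} * {ffun 'I_n -> 'I_n} => #|m.1|) (D, pi) mDpi.
apply: leq_trans; rewrite /= cardE -(size_map val) -(size_map fst).
apply: uniq_leq_size (matching_uniq1 ps) _ => i is1.
have /mapP[p /as_ /and3P[pn _ _] ip] := is1.
have i_n : (i < n)%N by rewrite ip.
by apply/mapP; exists (Ordinal i_n) => //; rewrite mem_enum inE.
Qed.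

Lemma max_common_subseqP k n (x y : n.-tuple 'I_k) m :
  (m <= \max_(m < n.+1 | common_subseq x y m) m)%N <->
  matchable (word_rel x y) n m.
Proof.
split=> [mmax|].
  apply: leq_matchable mmax _.
  elim/big_ind: _ => [||l /existsP[f /existsP[g]]].
  - exact: matchable0.
  - by move=> a b; exact: matchable_maxn.
  move=> /and3P[/'forall_forallP fm /'forall_forallP gm /forallP fg].
  exists [seq (val (f t), val (g t)) | t <- enum 'I_l]; last first.
    by rewrite size_map size_enum_ord.
  apply/andP; split; last first.
    by apply/allP => _ /mapP[t _ ->] /=; rewrite !ltn_ord word_relE fg.
  rewrite pairwise_map; apply: sub_pairwise (pairwise_enum_ord l) => t u tu.
  by rewrite /relpre /pair_lt/= (implyP (fm _ _) tu) (implyP (gm _ _) tu).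
case=> s /[dup] ms /andP[ps /allP as_] ks; apply: (leq_trans ks).
have sn : (size s < n.+1)%N.
  by rewrite ltnS; apply: (@matchable_size (word_rel x y)); exists s.
have nths (t : 'I_(size s)) : nth (0, 0)%N s t \in s by exact: mem_nth.
have H1 (t : 'I_(size s)) : ((nth (0, 0)%N s (val t)).1 < n)%N.
  by have /and3P[] := as_ _ (nths t).
have H2 (t : 'I_(size s)) : ((nth (0, 0)%N s (val t)).2 < n)%N.
  by have /and3P[] := as_ _ (nths t).
have cs : common_subseq x y (size s).
  apply/existsP; exists [ffun t => Ordinal (H1 t)].
  apply/existsP; exists [ffun t => Ordinal (H2 t)].
  have mono (t u : 'I_(size s)) : (t < u)%N ->
      pair_lt (nth (0, 0)%N s t) (nth (0, 0)%N s u).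
    by move=> tu; move/(pairwiseP (0, 0)%N): ps; apply; rewrite ?inE.
  apply/and3P; split.
  - apply/'forall_forallP => t u; apply/implyP => tu; rewrite !ffunE/=.
    by have /andP[] := mono _ _ tu.
  - apply/'forall_forallP => t u; apply/implyP => tu; rewrite !ffunE/=.
    by have /andP[] := mono _ _ tu.
  - apply/forallP => t; rewrite -word_relE !ffunE /=.
    by have /and3P[] := as_ _ (nths t).
exact: (@leq_bigmax_cond _ (fun m : 'I_n.+1 => common_subseq x y m)
  (fun m => nat_of_ord m) (Ordinal sn) cs).
Qed.

(** Both distances have the shape [1 - m / n] with [m] the largest size of a
    match; for [n = 0] this is [1], whatever the match. *)
Lemma match_ratio_le (R : realType) (n m : nat) (c : R) : (0 < n)%N ->
  (1 - m%:R / n%:R <= c) = ((1 - c) * n%:R <= m%:R).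
Proof.
move=> n0; have n0R : 0 < n%:R :> R by rewrite ltr0n.
by rewrite lerBlDr addrC -lerBlDr ler_pdivlMr.
Qed.

Lemma match_ratio_lt (R : realType) (n m : nat) (c : R) : (0 < n)%N ->
  (1 - m%:R / n%:R < c) = ((1 - c) * n%:R < m%:R).
Proof.
move=> n0; have n0R : 0 < n%:R :> R by rewrite ltr0n.
by rewrite ltrBlDr addrC -ltrBlDr ltr_pdivlMr.
Qed.

(** * The null relation of the Feldman-Katok pseudometric *)

Lemma bounded_itv01 (R : realType) (u : nat -> R) :
  (forall n, 0 <= u n <= 1) -> bounded_fun (u : R^o^nat).
Proof.
move=> u01; exists 1; split; first exact: num_real.
move=> M M1 n _; have /andP[u0 u1] := u01 n.
by rewrite /= ger0_norm// (le_trans u1)// ltW.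
Qed.

Lemma limn_sup_lt (R : realType) (u : nat -> R) (c : R) :
  (forall n, 0 <= u n <= 1) -> limn_sup (u : R^o^nat) < c ->
  exists N, forall n, (N <= n)%N -> u n < c.
Proof.
move=> u01; have bu := bounded_itv01 u01.
rewrite limn_supE// => /inf_lt [|_ [N _ <-] uNc].
  by exists (sups (u : R^o^nat) 0%N); exists 0%N.
exists N => n Nn; apply: le_lt_trans uNc; apply: ub_le_sup; last by exists n.
exact/has_ubound_sdrop/bounded_fun_has_ubound.
Qed.

Lemma limn_sup_le (R : realType) (u : nat -> R) (c : R) N :
  (forall n, 0 <= u n <= 1) -> (forall n, (N <= n)%N -> u n <= c) ->
  limn_sup (u : R^o^nat) <= c.
Proof.
move=> u01 uc; have bu := bounded_itv01 u01; rewrite limn_supE//.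
apply: (@le_trans _ _ (sups (u : R^o^nat) N)).
  by apply: ge_inf; [exact: bounded_fun_has_lbound_sups|exists N].
by apply: ge_sup => [|_ [n /= Nn <-]]; [exists (u N); exists N => /=|exact: uc].
Qed.

Lemma fbar_match01 (R : realType) (X : metricType R) (T : X -> X) (e : R) x y n :
  0 <= fbar_match T e x y n <= 1.
Proof.
rewrite /fbar_match subr_ge0 gerDl oppr_le0 divr_ge0// andbT.
case: n => [|n]; first by rewrite invr0 mulr0.
rewrite ler_pdivrMr ?ltr0n// mul1r ler_nat.
exact/matchable_size/max_matchP.
Qed.

Lemma max_match_le (R : realType) (X : metricType R) (T : X -> X) (d e : R)
    x y n : d <= e -> (max_match T n d x y <= max_match T n e x y)%N.
Proof.
move=> de; apply/max_matchP.
apply: sub_matchable (proj1 (max_matchP T d x y n _) (leqnn _)) => i j _ _ h.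
exact: lt_le_trans h de.
Qed.

Lemma max_match_sym (R : realType) (X : metricType R) (T : X -> X) (e : R)
    x y n : (max_match T n e x y <= max_match T n e y x)%N.
Proof.
apply/max_matchP.
apply: matchable_sym (proj1 (max_matchP T e x y n _) (leqnn _)) => i j.
by rewrite /orbit_rel metric_sym.
Qed.

Lemma max_match_triangle (R : realType) (X : metricType R) (T : X -> X)
    (d e : R) x y z n :
  (max_match T n d x y + max_match T n e y z <= max_match T n (d + e) x z + n)%N.
Proof.
have /max_matchP : matchable (orbit_rel T (d + e) x z) n
    (max_match T n d x y + max_match T n e y z - n).
  apply: matchable_comp (proj1 (max_matchP T d x y n _) (leqnn _))
                        (proj1 (max_matchP T e y z n _) (leqnn _)) => i j l ij jl.
  exact: le_lt_trans (metric_triangle _ _ _) (ltrD ij jl).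
lia.
Qed.

(** The quantity [fbar_lim] decreases with the threshold, because a match for
    [delta] is a match for every larger threshold; hence the limit superior and
    the infimum may be traded for a bound at all large times. *)
Lemma dFK0P (R : realType) (X : metricType R) (T : X -> X) x y :
  dFK T x y = 0 <->
  forall e : R, 0 < e -> exists N, forall n, (N <= n)%N ->
    (1 - e) * n%:R <= (max_match T n e x y)%:R.
Proof.
rewrite /dFK; set S := (X in inf X).
have S2 : S 2.
  split=> //; apply: (@le_lt_trans _ _ 1); last by rewrite ltr1n.
  apply: (@limn_sup_le _ _ _ 0) => n; first exact: fbar_match01.
  by have /andP[] := fbar_match01 T 2 x y n.
have S0 : lbound S 0 by move=> d [/ltW].
split=> [infS0 e e0|h].
  move: (e0); rewrite -{1}infS0 => /inf_lt [|d [d0 xyd] de]; first by exists 2.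
  have [N hN] := limn_sup_lt (fbar_match01 T d x y) xyd.
  exists N.+1 => n Nn; have n0 : (0 < n)%N by case: n Nn.
  have := hN _ (ltnW Nn); rewrite /fbar_match match_ratio_lt// => /ltW xyn.
  apply: (@le_trans _ _ ((1 - d) * n%:R)).
    by rewrite ler_wpM2r// lerD2l lerN2 ltW.
  by rewrite (le_trans xyn)// ler_nat max_match_le// ltW.
apply/eqP; rewrite eq_le lb_le_inf ?andbT//; last by exists 2.
apply/ler_addgt0Pl => e e0; rewrite addr0.
apply: ge_inf; first by exists 0.
split=> //; have e20 : 0 < e / 2 by rewrite divr_gt0.
have [N hN] := h _ e20.
apply: (@le_lt_trans _ _ (e / 2)); last by rewrite ltr_pdivrMr// ltr_pMr// ltr1n.
apply: (@limn_sup_le _ _ _ N.+1) => n; first exact: fbar_match01.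
move=> Nn; have n0 : (0 < n)%N by case: n Nn.
rewrite /fbar_match match_ratio_le// (le_trans (hN n (ltnW Nn)))// ler_nat.
by rewrite max_match_le// ler_pdivrMr// ler_peMr ?ltW// ltr1n.
Qed.

Lemma dFK0_sym (R : realType) (X : metricType R) (T : X -> X) x y :
  dFK T x y = 0 -> dFK T y x = 0.
Proof.
move=> /dFK0P h; apply/dFK0P => e /h [N hN]; exists N => n /hN xy.
by rewrite (le_trans xy)// ler_nat max_match_sym.
Qed.

Lemma dFK0_trans (R : realType) (X : metricType R) (T : X -> X) x y z :
  dFK T x y = 0 -> dFK T y z = 0 -> dFK T x z = 0.
Proof.
move=> /dFK0P h1 /dFK0P h2; apply/dFK0P => e e0.
have e20 : 0 < e / 2 by rewrite divr_gt0.
have [N1 xy] := h1 _ e20; have [N2 yz] := h2 _ e20.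
exists (maxn N1 N2) => n; rewrite geq_max => /andP[/xy xyn /yz yzn].
have := max_match_triangle T (e / 2) (e / 2) x y z n.
rewrite -(ler_nat R) !natrD -splitr; lra.
Qed.

(** * Topology and measurability *)

Lemma open_mdist (R : realType) (X : metricType R) (x : X) (e : R) :
  open [set y | mdist x y < e].
Proof.
rewrite openE => y /= xy; apply/nbhs_ballP.
exists (e - mdist x y); first by rewrite /= subr_gt0.
move=> z; rewrite ballEmdist /= ltrBrDl; apply: le_lt_trans.
exact: metric_triangle.
Qed.

Lemma finite_net (R : realType) (X : pointedMetricType R) (e : R) :
  compact [set: X] -> 0 < e ->
  exists s : seq X, forall x, exists2 z, z \in s & mdist z x < e.
Proof.
rewrite compact_cover => cX e0.
have [|x _|D _ cD] := cX X [set: X] (fun z => [set y | mdist z y < e]).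
- by move=> z _; exact: open_mdist.
- by exists x => //=; rewrite mdistxx.
exists (finmap.enum_fset D) => x; have [z /= zD zx] := cD x I; by exists z.
Qed.

Lemma open_borel (R : realType) (X : pointedMetricType R) (A : set (borel X)) :
  open (A : set X) -> measurable A.
Proof. by move=> oA; apply: sub_sigma_algebra. Qed.

Lemma measurable_preimage (R : realType) (X : pointedMetricType R)
    (T : X -> X) (A : set (borel X)) : continuous T ->
  measurable A -> measurable (T @^-1` A : set (borel X)).
Proof.
move=> cT mA; rewrite -[X in measurable X]setTI.
have mT : measurable_fun [set: borel X] (T : borel X -> borel X).
  apply: (@measurability _ _ (borel X) (borel X) setT T (@open X)); first by [].

  move=> _ [B oB <-]; rewrite setTI; apply: open_borel.
  by move/continuousP : cT; apply.
exact: mT.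
Qed.

Lemma measurable_preimage_iter (R : realType) (X : pointedMetricType R)
    (T : X -> X) n (A : set (borel X)) : continuous T ->
  measurable A -> measurable (iter n T @^-1` A : set (borel X)).
Proof.
move=> cT; elim: n A => [|n IH] A mA; first exact: mA.
exact: IH (measurable_preimage cT mA).
Qed.

Lemma measure_preimage_iter (R : realType) (X : pointedMetricType R)
    (T : X -> X) (mu : probability (borel X) R) n (A : set (borel X)) :
  continuous T -> invariant_measure T mu -> measurable A ->
  mu (iter n T @^-1` A) = mu A.
Proof.
move=> cT hmu; elim: n A => [//|n IH] A mA.
rewrite -(hmu _ mA) -(IH _ (measurable_preimage cT mA)).
by congr (mu _).
Qed.

(** The metric is measurable for the product of the Borel sigma-algebras: by
    total boundedness the set [d < e] is a countable union of products of
    balls. *)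
Lemma measurable_orbit_rel (R : realType) (X : pointedMetricType R)
    (T : X -> X) (e : R) i j : compact [set: X] -> continuous T ->
  measurable [set p : borel X * borel X | orbit_rel T e p.1 p.2 i j].
Proof.
move=> cX cT; pose r m : R := m.+1%:R^-1.
have r0 m : 0 < r m by rewrite invr_gt0.
have /choice[s sP] m : exists s : seq X, forall x,
  exists2 z, z \in s & mdist z x < r m by exact: finite_net.
pose B m z : set (borel X * borel X) :=
  (iter i T @^-1` [set y | mdist z y < r m]) `*`
  (iter j T @^-1` [set y | mdist z y < e - r m]).
rewrite (_ : [set p | _] = \bigcup_m \bigcup_(z in [set` s m]) B m z).
  apply: bigcupT_measurable => m; apply: fin_bigcup_measurable => // z _.
  have mb c : measurable ([set y | mdist z y < c] : set (borel X)).
    by apply: open_borel; exact: open_mdist.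
  by apply: measurableX; exact: measurable_preimage_iter.
apply/seteqP; split=> [[x y]|[x y] [m _ [z _ [/= zx zy]]]]; rewrite /orbit_rel/=.
  set u := iter i T x; set v := iter j T y => uv.
  have e0 : 0 < (e - mdist u v) / 2 by rewrite divr_gt0// subr_gt0.
  have [m _ /(_ _ (leqnn _)) mP] := near_infty_natSinv_lt (PosNum e0).
  have [z zs zu] := sP m u; exists m => //; exists z => //; split => //=.
  have := metric_triangle z u v; rewrite -/v.
  rewrite /= in mP; rewrite -/(r m) in mP; lra.
have := metric_triangle (iter i T x) z (iter j T y).
rewrite (metric_sym _ z); lra.
Qed.

(** A match is one of countably many lists of pairs, each tested by finitely
    many inequalities between distances. *)
Lemma measurable_max_match_geq (R : realType) (X : pointedMetricType R)
    (T : X -> X) (e : R) n k : compact [set: X] -> continuous T ->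
  measurable [set p : borel X * borel X | (k <= max_match T n e p.1 p.2)%N].
Proof.
move=> cX cT.
have mall (s : seq (nat * nat)) :
    measurable [set p : borel X * borel X |
                matching (orbit_rel T e p.1 p.2) n s && (k <= size s)%N].
  rewrite (_ : [set _ | _] = [set p : borel X * borel X |
      all (fun q => [&& (q.1 < n)%N, (q.2 < n)%N & orbit_rel T e p.1 p.2 q.1 q.2]) s]
      `&` [set _ | pairwise pair_lt s && (k <= size s)%N]); last first.
    apply/seteqP; split=> p /=; rewrite /matching.
      by move=> /andP[/andP[-> ->] ->].
    by move=> [-> /andP[-> ->]].
  apply: measurableI.
    elim: s => [|q s IH] /=; first by rewrite set_true.
    rewrite (_ : [set _ | _] = ([set p : borel X * borel X |
        orbit_rel T e p.1 p.2 q.1 q.2] `&` [set _ | (q.1 < n)%N && (q.2 < n)%N]) `&`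
        [set p : borel X * borel X |
        all (fun q => [&& (q.1 < n)%N, (q.2 < n)%N & orbit_rel T e p.1 p.2 q.1 q.2]) s]).
      apply: measurableI => //; apply: measurableI.
        exact: measurable_orbit_rel.
      by case: (_ && _); rewrite ?set_true ?set_false.
    apply/seteqP; split=> p /=.
      by move=> /andP[/and3P[-> -> ->] ->].
    by move=> [[-> /andP[-> ->]] ->].
  by case: (_ && _); rewrite ?set_true ?set_false.
rewrite (_ : [set _ | _] = \bigcup_(s : seq (nat * nat)) [set p : borel X * borel X |
                matching (orbit_rel T e p.1 p.2) n s && (k <= size s)%N]).
  exact: countable_bigcupT_measurable.
apply/seteqP; split=> p /=.
  by move=> /max_matchP[s ms ks]; exists s => //=; rewrite ms ks.
by move=> [s _ /= /andP[ms ks]]; apply/max_matchP; exists s.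
Qed.

Lemma measurable_max_match_ge (R : realType) (X : pointedMetricType R)
    (T : X -> X) (e a : R) n : compact [set: X] -> continuous T ->
  measurable [set p : borel X * borel X | a <= (max_match T n e p.1 p.2)%:R].
Proof.
move=> cX cT; rewrite (_ : [set _ | _] = \bigcup_(k in [set k : nat | a <= k%:R])
    [set p : borel X * borel X | (k <= max_match T n e p.1 p.2)%N]).
  by apply: bigcup_measurable => k _; exact: measurable_max_match_geq.
apply/seteqP; split=> p /=; first by move=> ap; eexists; [exact: ap|exact: leqnn].
by move=> [k /= ak kp]; rewrite (le_trans ak)// ler_nat.
Qed.

Lemma measurable_eventually_close (R : realType) (X : pointedMetricType R)
    (T : X -> X) (e : R) N : compact [set: X] -> continuous T ->
  measurable [set p : borel X * borel X |
    forall n, (N <= n)%N -> (1 - e) * n%:R <= (max_match T n e p.1 p.2)%:R].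
Proof.
move=> cX cT; rewrite (_ : [set _ | _] = \bigcap_(n in [set n | (N <= n)%N])
    [set p : borel X * borel X | (1 - e) * n%:R <= (max_match T n e p.1 p.2)%:R]).
  apply: bigcap_measurable => [|n _]; first by exists N => /=.
  exact: measurable_max_match_ge.
by apply/seteqP; split=> p /= h n; exact: h.
Qed.

(** By [dFK0P] it is enough to test the countably many thresholds [1 / m]. *)
Lemma measurable_dFK0 (R : realType) (X : pointedMetricType R) (T : X -> X) :
  compact [set: X] -> continuous T ->
  measurable [set p : borel X * borel X | dFK T p.1 p.2 = 0].
Proof.
move=> cX cT; pose r m : R := m.+1%:R^-1.
have r0 m : 0 < r m by rewrite invr_gt0.
rewrite (_ : [set _ | _] = \bigcap_m \bigcup_N [set p : borel X * borel X |
    forall n, (N <= n)%N -> (1 - r m) * n%:R <= (max_match T n (r m) p.1 p.2)%:R]).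
  apply: bigcapT_measurable => m; apply: bigcupT_measurable => N.
  exact: measurable_eventually_close.
apply/seteqP; split=> p /=.
  by move=> /dFK0P h m _; have [N hN] := h _ (r0 m); exists N.
move=> h; apply/dFK0P => e e0.
have [m _ /(_ _ (leqnn _)) /= mP] := near_infty_natSinv_lt (PosNum e0).
have [N _ hN] := h m I; exists N => n /hN hn.
apply: (@le_trans _ _ ((1 - r m) * n%:R)).
  by rewrite ler_wpM2r// lerD2l lerN2 ltW.
by rewrite (le_trans hn)// ler_nat max_match_le// ltW.
Qed.

(** * Borel sets are continuous off a small set *)

Lemma decreasing_null_small (R : realType) d (S : measurableType d)
    (mu : probability S R) (F : nat -> set S) (eta : R) :
  (forall m, measurable (F m)) ->
  (forall m n, (m <= n)%N -> F n `<=` F m) ->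
  mu (\bigcap_m F m) = 0%E -> 0 < eta -> exists m, (mu (F m) < eta%:E)%E.
Proof.
move=> mF decF muF0 eta0.
have cF : (mu \o F) x @[x --> \oo] --> mu (\bigcap_m F m).
  apply: nonincreasing_cvg_mu => //.
  - by rewrite (le_lt_trans (probability_le1 _ _))// ltry.
  - exact: bigcapT_measurable.
  - by move=> m n mn; apply/subsetPset; exact: decF.
move: cF; rewrite muF0 => /fine_cvgP[_ /cvgr_lt /(_ eta eta0)].
case=> m _ /(_ m (leqnn m)) /= Fm; exists m.
by rewrite -(fineK (fin_num_measure mu _ (mF m))) lte_fin.
Qed.

(** A weak form of regularity: the indicator function of [A] becomes uniformly
    continuous once a set of small measure is deleted. One implication is
    enough because [u] and [v] can be exchanged. *)
Definition nearly_continuous (R : realType) (X : pointedMetricType R)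
    (mu : probability (borel X) R) (A : set X) : Prop :=
  forall eta : R, 0 < eta -> exists (Bad : set (borel X)) (delta : R),
    [/\ measurable Bad, (mu Bad < eta%:E)%E, 0 < delta &
     forall u v, ~ Bad u -> ~ Bad v -> mdist u v < delta -> A u -> A v].

Lemma nearly_continuousC (R : realType) (X : pointedMetricType R)
    (mu : probability (borel X) R) (A : set X) :
  nearly_continuous mu A -> nearly_continuous mu (~` A).
Proof.
move=> cA eta eta0; have [Bad [delta [mBad sBad d0 h]]] := cA _ eta0.
exists Bad, delta; split=> // u v bu bv uv Au Av.
by apply: Au; apply: h bv bu _ Av; rewrite metric_sym.
Qed.

Lemma nearly_continuous_seq (R : realType) (X : pointedMetricType R)
    (mu : probability (borel X) R) (I : eqType) (P : I -> set X) (s : seq I) :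
  (forall i, nearly_continuous mu (P i)) ->
  forall eta : R, 0 < eta -> exists (Bad : set (borel X)) (delta : R),
    [/\ measurable Bad, (mu Bad < eta%:E)%E, 0 < delta &
     forall u v, ~ Bad u -> ~ Bad v -> mdist u v < delta ->
     forall i, i \in s -> P i u -> P i v].
Proof.
move=> cP; elim: s => [|i s IH] eta eta0.
  by exists set0, 1; split; rewrite ?measure0 ?lte_fin.
have e20 : 0 < eta / 2 by rewrite divr_gt0.
have [B1 [d1 [mB1 sB1 d10 h1]]] := cP i _ e20.
have [B2 [d2 [mB2 sB2 d20 h2]]] := IH _ e20.
exists (B1 `|` B2), (Num.min d1 d2); split.
- exact: measurableU.
- rewrite (splitr eta) EFinD (le_lt_trans (measureU2 _ mB1 mB2))//.
  by rewrite lteD// fin_num_measure.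
- by rewrite lt_min d10 d20.
move=> u v /not_orP[u1 u2] /not_orP[v1 v2]; rewrite lt_min => /andP[uv1 uv2] j.
by rewrite inE => /predU1P[->|js]; [exact: h1|exact: h2].
Qed.

(** In an open set only the points near its complement are bad, and the layers
    of such points decrease to the empty set. *)
Lemma nearly_continuous_open (R : realType) (X : pointedMetricType R)
    (mu : probability (borel X) R) (A : set X) :
  open A -> nearly_continuous mu A.
Proof.
move=> oA eta eta0; pose r m : R := m.+1%:R^-1.
pose near_out m : set (borel X) := \bigcup_(y in ~` A) [set x | mdist y x < r m].
have mn m : measurable (near_out m).
  by apply: open_borel; apply: bigcup_open => y _; exact: open_mdist.
have mA : measurable (A : set (borel X)) by exact: open_borel.
have [| | | |m mP] := @decreasing_null_small _ _ _ mu (fun m => A `&` near_out m) eta.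
- by move=> m; exact: measurableI.
- move=> m n mn' x [Ax [y ny /= xy]]; split=> //; exists y => //=.
  by rewrite (lt_le_trans xy)// /r lef_pV2 ?posrE ?ltr0n// ler_nat ltnS.
- rewrite (_ : \bigcap_m _ = set0) ?measure0//.
  apply/seteqP; split=> // x h; have [Ax _] := h 0%N I.
  have /nbhs_ballP[e /= e0 eA] : nbhs x A by exact: open_nbhs_nbhs.
  have [m _ /(_ _ (leqnn _)) /= me] := near_infty_natSinv_lt (PosNum e0).
  have [_ [y ny /= yx]] := h m I; apply: ny; apply: eA; rewrite ballEmdist /=.
  by rewrite metric_sym (lt_trans yx).
- exact: eta0.
exists (A `&` near_out m), (r m); split; [exact: measurableI|exact: mP| |].
  by rewrite invr_gt0.
move=> u v bu _ uv Au; apply: contrapT => nAv.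
by apply: bu; split=> //; exists v => //=; rewrite metric_sym.
Qed.

(** The class of nearly continuous Borel sets is a sigma-algebra: a countable
    union is approximated in measure by one of its finite subunions, for which
    near continuity is immediate. *)
Lemma nearly_continuous_measurable (R : realType) (X : pointedMetricType R)
    (mu : probability (borel X) R) (A : set (borel X)) :
  measurable A -> nearly_continuous mu A.
Proof.
pose G := [set A : set (borel X) | measurable A /\ nearly_continuous mu A].
suff sG : sigma_algebra setT G.
  have : <<s @open X >> `<=` G.
    apply: smallest_sub sG _ => B oB.
    by split; [exact: open_borel|exact: nearly_continuous_open].
  by move=> h /h[].
split.
- by split=> // eta eta0; exists set0, 1; split; rewrite ?measure0 ?lte_fin.
- move=> B [mB cB]; rewrite setTD.
  by split; [exact: measurableC|exact: nearly_continuousC].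
move=> F GF; have mF n : measurable (F n) by have [] := GF n.
have mUF : measurable (\bigcup_k F k) by exact: bigcupT_measurable.
split=> // eta eta0; have e20 : 0 < eta / 2 by rewrite divr_gt0.
pose U m := \bigcup_(k < m) F k.
have mU m : measurable (U m) by apply: bigcup_measurable => k _.
have [| | | |m mP] := @decreasing_null_small _ _ _ mu
    (fun m => (\bigcup_k F k) `\` U m) (eta / 2).
- by move=> m; exact: measurableD.
- move=> m n mn x [Fx nU]; split=> // -[k /= km Fk]; apply: nU.
  by exists k => //=; exact: leq_trans mn.
- rewrite (_ : \bigcap_m _ = set0) ?measure0//.
  apply/seteqP; split=> // x h; have [[k _ Fk] _] := h 0%N I.
  by have [_] := h k.+1 I; apply; exists k => /=.
- exact: e20.
have cF i : nearly_continuous mu (F i) by have [] := GF i.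
have [Bad [delta [mBad sBad d0 h]]] := nearly_continuous_seq (iota 0 m) cF e20.
exists (Bad `|` ((\bigcup_k F k) `\` U m)), delta; split=> //.
- by apply: measurableU => //; exact: measurableD.
- rewrite (splitr eta) EFinD (le_lt_trans (measureU2 _ _ _))//.
    exact: measurableD.
  by rewrite lteD// fin_num_measure//; exact: measurableD.
move=> u v /not_orP[bu u2] /not_orP[bv _] uv Fu.
have [k /= km Fk] : U m u by apply: contrapT => nU; apply: u2; split.
by exists k => //; apply: h uv _ _ Fk => //; rewrite mem_iota.
Qed.

(** * A maximal inequality *)

Definition visits (X : Type) (T : X -> X) (B : set X) (x : X) (n : nat) : nat :=
  (\sum_(0 <= j < n) (iter j T x \in B))%N.

(** A pointwise comparison of two counting functions, integrated. *)
Lemma measure_count_le (R : realType) d (S : measurableType d)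
    (mu : probability S R) (c : R) (A B : nat -> set S) (m n : nat) : 0 <= c ->
  (forall i, measurable (A i)) -> (forall i, measurable (B i)) ->
  (forall x, c * (\sum_(0 <= i < m) (x \in A i))%:R
             <= (\sum_(0 <= j < n) (x \in B j))%:R) ->
  (c%:E * \sum_(0 <= i < m) mu (A i) <= \sum_(0 <= j < n) mu (B j))%E.
Proof.
move=> c0 mA mB h.
have intsum (C : nat -> set S) k : (forall i, measurable (C i)) ->
    (\int[mu]_x (\sum_(0 <= i < k) (\1_(C i) x)%:E) = \sum_(0 <= i < k) mu (C i))%E.
  move=> mC; rewrite ge0_integral_sum//.
    by apply: eq_bigr => i _; rewrite integral_indic// setIT.
  by move=> i; exact/measurable_EFinP.
have sumE (C : nat -> set S) k x : (\sum_(0 <= i < k) (\1_(C i) x)%:E =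
    ((\sum_(0 <= i < k) (x \in C i))%N%:R : R)%:E)%E.
  by rewrite natr_sum -sumEFin; apply: eq_bigr => i _; rewrite indicE.
have mf (C : nat -> set S) k : (forall i, measurable (C i)) ->
    measurable_fun setT (fun x => \sum_(0 <= i < k) (\1_(C i) x)%:E)%E.
  move=> mC; apply: emeasurable_sum => i.
  exact/measurable_EFinP.
rewrite -!intsum// -ge0_integralZl//.
- apply: ge0_le_integral => //.
  + by move=> x _; rewrite sumE -EFinM lee_fin mulr_ge0.
  + by apply: measurable_funeM; exact: mf.
  + exact: mf.
  + by move=> x _; rewrite !sumE -EFinM lee_fin.
- exact: mf.
- by move=> x _; rewrite sumE lee_fin.
Qed.

Lemma visits_iter (X : Type) (T : X -> X) (B : set X) (x : X) i n :
  visits T B (iter i T x) n = (\sum_(i <= j < i + n) (iter j T x \in B))%N.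
Proof.
transitivity (\sum_(0 + i <= j < i + n) (iter j T x \in B))%N; last by rewrite add0n.
rewrite big_addn addKn /visits.
by apply: eq_bigr => j _; rewrite -iterD.
Qed.

Lemma measurable_visits_ge (R : realType) (X : pointedMetricType R) (T : X -> X)
    (B : set (borel X)) (a : R) n : continuous T -> measurable B ->
  measurable [set x : borel X | a <= (visits T B x n)%:R].
Proof.
move=> cT mB.
have mf : measurable_fun [set: borel X] (fun x : borel X =>
    \sum_(0 <= j < n) (\1_(iter j T @^-1` B : set (borel X)) x : R)).
  apply: measurable_sum => j; apply: measurable_indic.
  exact: measurable_preimage_iter.
have := mf measurableT _ (measurable_itv `[a, +oo[); rewrite setTI.
congr (measurable _); apply/seteqP.
have E x : \sum_(0 <= j < n) (\1_(iter j T @^-1` B : set (borel X)) x : R) =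
    (visits T B x n)%:R.
  by rewrite natr_sum; apply: eq_bigr => j _; rewrite indicE.
by split=> x /=; rewrite in_itv /= andbT E.
Qed.

(** Points from which some window has many visits to [B] are themselves rarely
    visited: covering a long orbit segment by such windows bounds their number
    by the visits to [B], and invariance turns counts into measures. *)
Lemma visits_maximal_inequality_upto (R : realType) (X : pointedMetricType R)
    (T : X -> X) (mu : probability (borel X) R) (B : set (borel X)) (c : R) K :
  continuous T -> invariant_measure T mu -> measurable B -> 0 <= c ->
  let E := [set x : borel X | exists N, [/\ (0 < N)%N, (N <= K)%N &
             c * N%:R <= (visits T B x N)%:R]] in
  measurable E /\ (c%:E * mu E <= mu B)%E.
Proof.
move=> cT hmu mB c0 E.
have mE : measurable E.
  rewrite (_ : E = \bigcup_(N in [set N | (0 < N <= K)%N])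
      [set x : borel X | c * N%:R <= (visits T B x N)%:R]).
    by apply: bigcup_measurable => N _; exact: measurable_visits_ge.
  apply/seteqP; split=> x.
    by move=> [N [N0 NK h]]; exists N => //=; rewrite N0 NK.
  by move=> [N /= /andP[N0 NK] h]; exists N; split.
split=> //.
have count_le L : (c%:E * \sum_(0 <= i < L) mu (iter i T @^-1` E)
    <= \sum_(0 <= j < L + K) mu (iter j T @^-1` B))%E.
  apply: measure_count_le => // [i|i|x].
  - exact: measurable_preimage_iter.
  - exact: measurable_preimage_iter.
  apply: (@density_covering _ c (fun i => iter i T x \in E)
    (fun i => iter i T x \in B) K c0 _ L 0%N) => i.
  rewrite inE => -[N [N0 NK h]]; exists N; split=> //.
  by rewrite -visits_iter.
have Ee : mu E = (fine (mu E))%:E by rewrite fineK// fin_num_measure.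
have Be : mu B = (fine (mu B))%:E by rewrite fineK// fin_num_measure.
set e := fine (mu E) in Ee; set b := fine (mu B) in Be.
have b0 : 0 <= b by rewrite /b fine_ge0.
have real_le L : c * (e * L%:R) <= b * (L + K)%:R.
  have := count_le L.
  rewrite (eq_bigr (fun=> e%:E)); last first.
    by move=> i _; rewrite measure_preimage_iter.
  rewrite [X in (_ <= X)%E](eq_bigr (fun=> b%:E)); last first.
    by move=> i _; rewrite measure_preimage_iter.
  rewrite !sumEFin !sumr_const_nat !subn0 -EFinM lee_fin.
  by rewrite -(mulr_natr e) -(mulr_natr b).
rewrite Ee Be -EFinM lee_fin leNgt; apply/negP => lt_b.
have D0 : 0 < c * e - b by rewrite subr_gt0.
have := archi_boundP (divr_ge0 (mulr_ge0 b0 (ler0n R K)) (ltW D0)).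
rewrite ltr_pdivrMr//; set L := Num.bound _.
have := real_le L; rewrite natrD; lra.
Qed.

(** The weak-type maximal inequality of ergodic theory for an indicator
    function; the bound for windows of length at most [K] is uniform in [K]. *)
Lemma visits_maximal_inequality (R : realType) (X : pointedMetricType R)
    (T : X -> X) (mu : probability (borel X) R) (B : set (borel X)) (c : R) :
  continuous T -> invariant_measure T mu -> measurable B -> 0 <= c ->
  exists E : set (borel X), [/\ measurable E, (c%:E * mu E <= mu B)%E &
    forall x, ~ E x -> forall n, (visits T B x n)%:R <= c * n%:R].
Proof.
move=> cT hmu mB c0.
pose E K := [set x : borel X | exists N, [/\ (0 < N)%N, (N <= K)%N &
             c * N%:R <= (visits T B x N)%:R]].
have [mE leE] : (forall K, measurable (E K)) /\
    (forall K, (c%:E * mu (E K) <= mu B)%E).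
  by split=> K; have [] := visits_maximal_inequality_upto K cT hmu mB c0.
have mU : measurable (\bigcup_K E K) by exact: bigcupT_measurable.
exists (\bigcup_K E K); split=> //; last first.
  move=> x nE [|n]; first by rewrite /visits big_geq// mulr0.
  rewrite leNgt; apply/negP => /ltW h; apply: nE; exists n.+1 => //.
  by exists n.+1.
have cE : (mu \o E) x @[x --> \oo] --> mu (\bigcup_K E K).
  apply: nondecreasing_cvg_mu => // m n mn; apply/subsetPset => x [N [N0 Nm h]].
  by exists N; split=> //; exact: leq_trans mn.
have cEc : (c%:E * mu (E n))%E @[n --> \oo] --> (c%:E * mu (\bigcup_K E K))%E.
  exact: cvgeZl.
rewrite -(cvg_lim _ cEc)//; apply: lime_le; first by apply/cvg_ex; eexists; exact: cEc.
by apply: nearW => n; exact: leE.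
Qed.

(** * From almost every pair to a set of full measure, and back *)

Lemma full_measure_nonempty (R : realType) d (S : measurableType d)
    (mu : probability S R) (A : set S) : mu A = 1%E -> exists x, A x.
Proof.
move=> A1; apply: contrapT => nA.
have : A = set0 by apply/seteqP; split=> // x Ax; apply: nA; exists x.
by move=> A0; move: A1; rewrite A0 measure0 => /eqP; rewrite eq_sym onee_eq0.
Qed.

Lemma probability_setC_eq0 (R : realType) d (S : measurableType d)
    (mu : probability S R) (A : set S) : measurable A ->
  mu (~` A) = 0%E -> mu A = 1%E.
Proof.
move=> mA A0; rewrite -[A]setCK probability_setC ?A0 ?sube0//.
exact: measurableC.
Qed.

Lemma product_setT (R : realType) d (S : measurableType d)
    (mu : probability S R) : (mu \x mu)%E [set: S * S] = 1%E.
Proof.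
rewrite -setXTT product_measure1E// -[RHS](mule1 1%E).
by congr (_ * _)%E; exact: probability_setT.
Qed.

(** By Tonelli almost every section of the complement is null. *)
Lemma full_section (R : realType) d (S : measurableType d)
    (mu : probability S R) (A : set (S * S)) : measurable A ->
  (mu \x mu)%E A = 1%E -> exists x, mu (xsection A x) = 1%E.
Proof.
move=> mA A1.
have nA0 : (mu \x mu)%E (~` A) = 0%E.
  have : (mu \x mu)%E (A `|` ~` A) = ((mu \x mu)%E A + (mu \x mu)%E (~` A))%E.
    by apply: measureU => //; [exact: measurableC|exact: setICr].
  rewrite setUv product_setT A1.
  have : (mu \x mu)%E (~` A) \is a fin_num.
    rewrite ge0_fin_numE// (le_lt_trans (y := 1%E)) ?ltry//.
    have <- := product_setT mu.
    by apply: le_measure; rewrite ?inE//; exact: measurableC.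
  case: ((mu \x mu)%E (~` A)) => // r _ /eqP.
  by rewrite -EFinD eqe -subr_eq0 opprD addrA subrr add0r oppr_eq0 => /eqP ->.
have mnA : measurable (~` A) by exact: measurableC.
have mf := measurable_fun_xsection mu mnA.
have : (\int[mu]_(x in setT) `|(mu \o xsection (~` A)) x| = 0)%E.
  by rewrite -[RHS]nA0; apply: eq_integral => x _; rewrite gee0_abs.
move=> /(ae_eq_integral_abs mu measurableT mf) [N [mN N0 subN]].
have [x nNx] : exists x, (~` N) x.
  apply: (@full_measure_nonempty _ _ _ mu).
  by rewrite probability_setC// N0 sube0.
exists x; apply: probability_setC_eq0; first exact: measurable_xsection.
have <- : (mu \o xsection (~` A)) x = 0%E.
  by apply: contrapT => h; apply: nNx; apply: subN => /= /(_ I).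
rewrite /=; congr (mu _); apply/seteqP; split=> y /=;
  by rewrite /xsection /= !inE.
Qed.

(** Being at distance zero is an equivalence relation, so a section of full
    measure is a class of full measure. *)
Lemma FK_ae_full_set (R : realType) (X : pointedMetricType R) (T : X -> X)
    (mu : probability (borel X) R) : compact [set: X] -> continuous T ->
  (mu \x mu)%E [set p : borel X * borel X | dFK T p.1 p.2 = 0] = 1%E ->
  exists M : set (borel X),
    [/\ measurable M, mu M = 1%E & forall x y, M x -> M y -> dFK T x y = 0].
Proof.
move=> cX cT S1; have mA := measurable_dFK0 cX cT.
have [x x1] := full_section mA S1.
exists (xsection [set p : borel X * borel X | dFK T p.1 p.2 = 0] x).
split=> //; first exact: measurable_xsection.
move=> y z /set_mem xy /set_mem xz.
exact: dFK0_trans (dFK0_sym xy) xz.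
Qed.

Lemma FK_full_set_ae (R : realType) (X : pointedMetricType R) (T : X -> X)
    (mu : probability (borel X) R) (M : set (borel X)) :
  compact [set: X] -> continuous T ->
  measurable M -> mu M = 1%E -> (forall x y, M x -> M y -> dFK T x y = 0) ->
  (mu \x mu)%E [set p : borel X * borel X | dFK T p.1 p.2 = 0] = 1%E.
Proof.
move=> cX cT mM M1 hM; have mA := measurable_dFK0 cX cT.
apply/eqP; rewrite eq_le; apply/andP; split.
  have <- := product_setT mu.
  by apply: le_measure; rewrite ?inE.
have <- : (mu \x mu)%E (M `*` M) = 1%E.
  by rewrite product_measure1E// -[RHS](mule1 1%E) -M1.
apply: le_measure; rewrite ?inE//; first exact: measurableX.
by move=> [x y] [/= Mx My]; exact: hM.
Qed.

(** * From a set of full measure to short words *)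

Lemma partition_label (R : realType) (X : pointedMetricType R) (k : nat)
    (P : 'I_k -> set (borel X)) : measurable_partition P ->
  exists lab : X -> 'I_k, forall i x, P i x <-> lab x = i.
Proof.
move=> [[cov triv _] _].
have /choice[lab labP] (x : X) : exists i, P i x.
  have : [set: borel X] x by [].
  by rewrite -cov => -[i _ Pix]; exists i.
exists lab => i x; split=> [Pix|<-//].
apply: (triv (lab x) i) => //.
by exists x.
Qed.

Definition name (X : Type) (T : X -> X) (k : nat) (lab : X -> 'I_k) (n : nat)
    (x : X) : n.-tuple 'I_k := [tuple lab (iter i T x) | i < n].

Lemma name_rel (X : Type) (T : X -> X) (k n : nat) (lab : X -> 'I_k) x y
    (i j : nat) : (i < n)%N -> (j < n)%N ->
  word_rel (name T lab n x) (name T lab n y) i j =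
  (lab (iter i T x) == lab (iter j T y)).
Proof.
move=> ni nj.
by rewrite -[i]/(val (Ordinal ni)) -[j]/(val (Ordinal nj)) word_relE !tnth_mktuple.
Qed.

Lemma measurable_cell (R : realType) (X : pointedMetricType R) (T : X -> X)
    (k n : nat) (P : 'I_k -> set (borel X)) (w : n.-tuple 'I_k) :
  continuous T -> (forall i, measurable (P i)) ->
  measurable (cell T P w : set (borel X)).
Proof.
move=> cT mP; apply: fin_bigcap_measurable => // i _.
exact: measurable_preimage_iter.
Qed.

Lemma measurable_cells (R : realType) (X : pointedMetricType R) (T : X -> X)
    (k n : nat) (P : 'I_k -> set (borel X)) (W : set (n.-tuple 'I_k)) :
  continuous T -> (forall i, measurable (P i)) ->
  measurable (\bigcup_(w in W) cell T P w : set (borel X)).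
Proof.
move=> cT mP; apply: fin_bigcup_measurable => [|w _]; first exact: finite_finset.
exact: measurable_cell.
Qed.

(** The property known as loosely Kronecker, or loosely Bernoulli of entropy
    zero: the names of each large length concentrate near a single word. *)
Definition short_words (R : realType) (X : pointedMetricType R) (T : X -> X)
    (mu : probability (borel X) R) : Prop :=
  forall (k : nat) (P : 'I_k -> set (borel X)), measurable_partition P ->
  forall eps : R, 0 < eps ->
  exists N : nat, forall n : nat, (N < n)%N ->
  exists2 w : n.-tuple 'I_k, join_words T P w &
    ((1 - eps)%:E <=
     mu (\bigcup_(w' in [set w' | join_words T P w' /\
                                  (edit_dist R w w' < eps)%R])
           cell T P w'))%E.

(** The time from which an orbit stays close to that of [x0] is finite almost
    everywhere, hence bounded off a small set. *)
Lemma eventually_uniform (R : realType) (X : pointedMetricType R) (T : X -> X)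
    (mu : probability (borel X) R) (M : set (borel X)) x0 (e eta : R) :
  compact [set: X] -> continuous T ->
  measurable M -> mu M = 1%E -> (forall y, M y -> dFK T x0 y = 0) ->
  0 < e -> 0 < eta ->
  exists N (H : set (borel X)), [/\ measurable H, (mu (~` H) < eta%:E)%E &
    forall y n, H y -> (N <= n)%N -> (1 - e) * n%:R <= (max_match T n e x0 y)%:R].
Proof.
move=> cX cT mM M1 hM e0 eta0.
pose H N : set (borel X) := [set y |
  forall n, (N <= n)%N -> (1 - e) * n%:R <= (max_match T n e x0 y)%:R].
have mH N : measurable (H N).
  have := measurable_xsection (x0 : borel X) (measurable_eventually_close e N cX cT).
  congr (measurable _); apply/seteqP; split=> y; first by move/set_mem.
  by move=> Hy; apply/mem_set.
have [| | | |N HN] := @decreasing_null_small _ _ _ mu (fun N => ~` H N) eta.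
- by move=> N; exact: measurableC.
- by move=> m n mn y; apply: contra_not => h k nk; apply: h; exact: leq_trans nk.
- apply/eqP; rewrite eq_le measure_ge0 andbT.
  have M0 : mu (~` M) = 0%E by rewrite probability_setC// M1 subee.
  rewrite -M0; apply: le_measure; rewrite ?inE.
  + by apply: bigcapT_measurable => N; exact: measurableC.
  + exact: measurableC.
  move=> y h My; have /dFK0P/(_ _ e0)[N hN] := hM y My.
  exact: h N I hN.
- exact: eta0.
by exists N, (H N); split=> // y n; apply.
Qed.

(** Most points stay close to one reference orbit [x0], and their orbits rarely
    meet the set where the partition is not uniformly continuous. A match of
    two such orbits, composed through [x0] and stripped of the bad positions,
    is therefore a common subsequence of their names. *)
Lemma full_set_short_words (R : realType) (X : pointedMetricType R) (T : X -> X)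
    (mu : probability (borel X) R) (M : set (borel X)) :
  compact [set: X] -> continuous T -> invariant_measure T mu ->
  measurable M -> mu M = 1%E -> (forall x y, M x -> M y -> dFK T x y = 0) ->
  short_words T mu.
Proof.
move=> cX cT hmu mM M1 hM k P partP eps eps0.
have [x0 Mx0] := full_measure_nonempty M1.
have [lab labP] := partition_label partP.
have mP i : measurable (P i) by have [_] := partP.
(* Points that have to be discarded cost [2 c] in measure. For the others the
   edit distance is at most [2 e + 2 c], where [2 e] comes from the two matches
   with [x0] and [2 c] from the visits to [Bad]; and [8 c <= eps]. *)
pose c := Num.min eps 1 / 8.
have c0 : 0 < c by rewrite divr_gt0// lt_min eps0 ltr01.
have c8 : c * 8 <= eps by rewrite /c divfK// ge_min lexx.
have c81 : c * 8 <= 1 by rewrite /c divfK// ge_min lexx orbT.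
have cc0 : 0 < c * c by rewrite mulr_gt0.
have ncP i : nearly_continuous mu (P i) by exact: nearly_continuous_measurable.
have [Bad [delta [mBad sBad d0 hBad]]] := nearly_continuous_seq (enum 'I_k) ncP cc0.
have [E [mE leE hE]] := visits_maximal_inequality cT hmu mBad (ltW c0).
have sE : (mu E <= c%:E)%E.
  have := le_trans leE (ltW sBad).
  rewrite -(fineK (fin_num_measure mu _ mE)) -EFinM !lee_fin.
  by rewrite ler_pM2l.
pose e := Num.min c (delta / 2).
have e0 : 0 < e by rewrite lt_min c0 divr_gt0.
have ec : e <= c by rewrite ge_min lexx.
have ed : e + e <= delta.
  have : e <= delta / 2 by rewrite ge_min lexx orbT.
  lra.
have [N [H [mH sH hH]]] := eventually_uniform cX cT mM M1 (hM x0 ^~ Mx0) e0 c0.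
pose Good := H `&` ~` E.
have mGood : measurable Good by apply: measurableI => //; exact: measurableC.
have leG : ((1 - 2 * c)%:E <= mu Good)%E.
  have mHC : measurable (~` H) by exact: measurableC.
  have -> : Good = ~` (~` H `|` E) by rewrite setCU setCK.
  rewrite probability_setC; last exact: measurableU.
  have : (mu (~` H `|` E) <= (2 * c)%:E)%E.
    rewrite (le_trans (measureU2 _ mHC mE))// mulrDl mul1r EFinD.
    by rewrite leeD// ltW.
  rewrite -(fineK (fin_num_measure mu _ (measurableU _ _ mHC mE))).
  rewrite -EFinB !lee_fin; lra.
have [y0 Gy0] : exists y, Good y.
  apply: contrapT => nG; move: leG.
  have -> : Good = set0 by apply/seteqP; split=> // y Gy; apply: nG; exists y.
  by rewrite measure0 lee_fin; lra.
have cell_name n y : cell T P (name T lab n y) y.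
  by move=> i _; apply/labP; rewrite tnth_mktuple.
have close n y : (N < n)%N -> Good y ->
    edit_dist R (name T lab n y0) (name T lab n y) < eps.
  move=> Nn [Hy nEy]; have [Hy0 nEy0] := Gy0.
  have n0 : (0 < n)%N by case: n Nn.
  have n0R : 0 < n%:R :> R by rewrite ltr0n.
  have y0x := le_trans (hH _ _ Hy0 (ltnW Nn)) _.
  have m0 : (1 - e) * n%:R <= (max_match T n e y0 x0)%:R.
    by apply: y0x; rewrite ler_nat max_match_sym.
  have m1 := hH _ _ Hy (ltnW Nn).
  have m01 := max_match_triangle T e e y0 x0 y n.
  set q := max_match T n (e + e) y0 y in m01.
  have := proj1 (max_matchP T (e + e) y0 y n q) (leqnn _).
  move=> /(matchable_restrict (fun i => iter i T y0 \in Bad)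
                              (fun i => iter i T y \in Bad)).
  set q' := (q - _)%N => mq'.
  have : matchable (word_rel (name T lab n y0) (name T lab n y)) n q'.
    apply: sub_matchable mq' => i j ni nj /and3P[].
    rewrite !notin_setE name_rel// /orbit_rel => uv bu bv.
    apply/eqP/esym/labP; apply: hBad bu bv (lt_le_trans uv ed) _ _ _.
      by rewrite mem_enum.
    exact/labP.
  move=> /max_common_subseqP; rewrite /edit_dist match_ratio_lt//.
  rewrite -(ler_nat R); apply: lt_le_trans.
  have v0 := hE _ nEy0 n; have v1 := hE _ nEy n.
  rewrite /visits in v0 v1.
  have : (q <= q' + (\sum_(0 <= i < n) (iter i T y0 \in Bad) +
                     \sum_(0 <= i < n) (iter i T y \in Bad)))%N.
    by rewrite addnC -leq_subLR.
  move: m01; rewrite -!(ler_nat R) !natrD => m01 qq'.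
  have : c * n%:R * 8 <= eps * n%:R by rewrite mulrAC ler_wpM2r// ltW.
  have : e * n%:R <= c * n%:R by rewrite ler_wpM2r// ltW.
  have : 0 < c * n%:R by rewrite mulr_gt0.
  lra.
exists N => n Nn; exists (name T lab n y0); first by exists y0.
apply: (@le_trans _ _ (mu Good)).
  by apply: le_trans leG; rewrite lee_fin; lra.
apply: le_measure; rewrite ?inE//; first exact: measurable_cells.
move=> y Gy; exists (name T lab n y); last exact: cell_name.
by split; [exists y|exact: close].
Qed.

(** * From short words to a set of full measure *)

Lemma measurable_constant d (S : measurableType d) (Q : Prop) :
  measurable [set _ : S | Q].
Proof.
have [q|nq] := pselect Q.
  by rewrite (_ : [set _ | _] = setT)//; apply/seteqP; split.
by rewrite (_ : [set _ | _] = set0)//; apply/seteqP; split.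
Qed.

Lemma measurable_find (R : realType) (X : pointedMetricType R) (I : Type)
    (U : I -> pred X) (s : seq I) i :
  (forall z, measurable ([set x | U z x] : set (borel X))) ->
  measurable ([set x | find (U ^~ x) s = i] : set (borel X)).
Proof.
move=> mU; elim: s i => [|z s IH] i /=.
  exact: (@measurable_constant _ (borel X)).
rewrite (_ : [set _ | _] = ([set x | U z x] `&` [set _ | i = 0%N]) `|`
    (~` [set x | U z x] `&` \bigcup_(j in [set j | j.+1 = i])
                              [set x | find (U ^~ x) s = j])).
  apply: measurableU; apply: measurableI => //.
  - exact: (@measurable_constant _ (borel X)).
  - exact: measurableC.
  - by apply: bigcup_measurable => j _; exact: IH.
apply/seteqP; split=> x /=.
  case: ifP => Uzx; first by move=> <-; left.
  by move=> <-; right; split; [|exists (find (U ^~ x) s)].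
case=> [[-> ->//]|[/negP/negbTE -> [j /= <- <-]//]].
Qed.

(** Points are labelled by the first ball of a finite net that contains them.
    Only the labels that occur are kept, since cells must be nonempty. *)
Lemma fine_partition (R : realType) (X : pointedMetricType R) (e : R) :
  compact [set: X] -> 0 < e ->
  exists k (P : 'I_k -> set (borel X)), measurable_partition P /\
    forall i u v, P i u -> P i v -> mdist u v < e.
Proof.
move=> cX e0; have [s sP] := finite_net cX (divr_gt0 e0 (ltr0n R 2)).
pose U (z x : X) := mdist z x < e / 2.
pose lab x := find (U ^~ x) s.
have lab_lt x : (lab x < size s)%N.
  by rewrite -has_find; apply/hasP; have [z zs zx] := sP x; exists z.
pose J := [set i : 'I_(size s) | `[< exists x, lab x = i >]]%SET.
exists #|J|, (fun a : 'I_#|J| => [set x | lab x = val (enum_val a)]); split; last first.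
  move=> i u v /= ui vi; have [x0 _ _] := sP u.
  have near x : U (nth x0 s (lab x)) x.
    by apply: (@nth_find _ x0 (U ^~ x)); rewrite has_find; exact: lab_lt.
  have := near u; have := near v; rewrite ui vi /U => zv zu.
  rewrite (le_lt_trans (metric_triangle u (nth x0 s (enum_val i)) v))//.
  by rewrite (splitr e) ltrD// metric_sym.
split; last first.
  move=> a; apply: measurable_find => z.
  by apply: open_borel; exact: open_mdist.
split.
- apply/seteqP; split=> // x _.
  have xJ : Ordinal (lab_lt x) \in J by rewrite inE; apply/asboolP; exists x.
  by exists (enum_rank_in xJ (Ordinal (lab_lt x))) => //=; rewrite enum_rankK_in.
- move=> a b _ _ [x [/= xa xb]]; apply: enum_val_inj; apply: val_inj.
  by rewrite /= -xa xb.
- by move=> a _; have := enum_valP a; rewrite inE => /asboolP[x xa]; exists x.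
Qed.

(** A single block length [n] is enough: by the maximal inequality every orbit
    outside a small set starts a good word of length [n] at a proportion at
    least [1 - e] of the times in any interval that begins at [0], so it is
    almost filled by disjoint good blocks, and any two good blocks match. *)
Lemma short_words_scale (R : realType) (X : pointedMetricType R) (T : X -> X)
    (mu : probability (borel X) R) (e : R) :
  compact [set: X] -> continuous T -> invariant_measure T mu ->
  short_words T mu -> 0 < e -> e <= 4^-1 ->
  exists E : set (borel X), [/\ measurable E, (mu E <= e%:E)%E &
    forall x y, ~ E x -> ~ E y -> exists N, forall n, (N <= n)%N ->
      (1 - 4 * e) * n%:R <= (max_match T n e x y)%:R].
Proof.
move=> cX cT hmu S3 e0 e4.
have [k [P [partP small]]] := fine_partition cX e0.
have mP i : measurable (P i) by have [_] := partP.
(* The maximal inequality divides the measure of the bad words by [e], hence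
   the choice of [e * e] for their measure. *)
have ee0 : 0 < e * e by rewrite mulr_gt0.
have eee : e * e <= e by rewrite ger_pMr//; lra.
have [N /(_ N.+1 (ltnSn _))[w _]] := S3 k P partP (e * e) ee0.
set n := N.+1; set W := \bigcup_(_ in _) _ => muW.
have mW : measurable (W : set (borel X)) by exact: measurable_cells.
have [E [mE leE hE]] := visits_maximal_inequality cT hmu (measurableC mW) (ltW e0).
exists E; split=> //.
  have : (mu (~` W) <= (e * e)%:E)%E.
    move: muW; rewrite probability_setC//.
    rewrite -(fineK (fin_num_measure mu _ mW)) -EFinB !lee_fin; lra.
  move=> /(le_trans leE); rewrite -(fineK (fin_num_measure mu _ mE)) -EFinM.
  by rewrite !lee_fin ler_pM2l.
move=> x y nEx nEy.
pose good (z : X) : pred nat := fun i => iter i T z \in W.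
(* A good word shares more than [(1 - e * e) * n], thus at least [c.+1], letters
   with [w]; two good words therefore share [q] letters through [w]. *)
pose c := Num.truncn ((1 - e * e) * n%:R).
have c_lt : (1 - e * e) * n%:R < c.+1%:R by exact: truncnS_gt.
have words u : u \in W -> exists w' : n.-tuple 'I_k,
    cell T P w' u /\ matchable (word_rel w w') n c.+1.
  move=> /set_mem[w' [_ ed] cu]; exists w'; split=> //.
  apply/max_common_subseqP; move: ed; rewrite /edit_dist match_ratio_lt//.
  by move=> h; rewrite -truncn_lt_nat// in h; rewrite mulr_ge0//; lra.
pose q := (c.+1 + c.+1 - n)%N.
have q_ge : (1 - 2 * (e * e)) * n%:R <= q%:R.
  have : (c.+1 + c.+1 <= q + n)%N by rewrite /q; lia.
  rewrite -(ler_nat R) !natrD; move: c_lt; lra.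
have blocks i j : good x i -> good y j ->
    matchable (fun u v => orbit_rel T e x y (i + u)%N (j + v)%N) n q.
  move=> /words[wx [cx mx]] /words[wy [cy my]].
  have : matchable (word_rel wx wy) n q.
    have mx' : matchable (word_rel wx w) n c.+1.
      apply: (@matchable_sym (word_rel w wx)) mx => u v.
      by rewrite /word_rel eq_sym.
    apply: matchable_comp mx' my => u v t.
    by rewrite /word_rel => /eqP ->.
  apply: sub_matchable => u v un vn.
  rewrite -[u]/(val (Ordinal un)) -[v]/(val (Ordinal vn)) word_relE => /eqP uv.
  rewrite /orbit_rel addnC iterD addnC iterD.
  apply: small (cx (Ordinal un) I) _; rewrite uv; exact: (cy (Ordinal vn) I).
have pack z L : ~ E z -> exists2 t, packing (good z) n L 0 t &
    (1 - e) * L%:R - n%:R <= (size t * n)%:R.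
  move=> nEz; have [t pt Lt] := @packing_exists (good z) n L (ltn0Sn N) L 0%N erefl.
  exists t => //; have := hE z nEz L; move: Lt; rewrite -(ler_nat R) !natrD.
  have -> : visits T (~` W) z L = (\sum_(0 <= i < L) ~~ good z i)%N.
    by apply: eq_bigr => i _; rewrite in_setC.
  lra.
exists (Num.truncn (n%:R / e)).+1 => L Le.
have nL : n%:R <= e * L%:R.
  have : n%:R / e < (Num.truncn (n%:R / e)).+1%:R by exact: truncnS_gt.
  move/lt_le_trans => /(_ L%:R); rewrite ler_nat => /(_ Le) /ltW.
  by rewrite ler_pdivrMr// mulrC.
have [tx px lx] := pack x L nEx; have [ty py ly] := pack y L nEy.
have /max_matchP := matchable_packing blocks px py.
rewrite -(ler_nat R); apply: le_trans.
set m := minn _ _.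
have mn : (1 - e) * L%:R - n%:R <= m%:R * n%:R.
  by rewrite -natrM /m /minn; case: ifP.
rewrite natrM; apply: (@le_trans _ _ ((m%:R * n%:R) * (1 - 2 * (e * e)))).
  apply: (@le_trans _ _ ((1 - 2 * e) * L%:R * (1 - 2 * (e * e)))).
    rewrite mulrAC ler_wpM2r//.
    have : 0 <= e * (e * e) by rewrite !mulr_ge0// ltW.
    lra.
  by apply: ler_wpM2r; [lra|lra].
by rewrite -mulrA ler_wpM2l// mulrC.
Qed.

(** Borel-Cantelli along the scales [2 ^- (m + 2)]: almost every point avoids all
    but finitely many of the exceptional sets. *)
Lemma short_words_full_set (R : realType) (X : pointedMetricType R) (T : X -> X)
    (mu : probability (borel X) R) :
  compact [set: X] -> continuous T -> invariant_measure T mu ->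
  short_words T mu ->
  exists M : set (borel X),
    [/\ measurable M, mu M = 1%E & forall x y, M x -> M y -> dFK T x y = 0].
Proof.
move=> cX cT hmu S3; pose r m : R := (2 ^ m.+2)%:R^-1.
have r0 m : 0 < r m by rewrite invr_gt0 ltr0n expn_gt0.
have r4 m : r m <= 4^-1.
  rewrite lef_pV2 ?posrE ?ltr0n ?expn_gt0// ler_nat.
  by rewrite (leq_pexp2l (isT : (0 < 2)%N) (isT : (2 <= m.+2)%N)).
have /choice[E EP] m := short_words_scale cX cT hmu S3 (r0 m) (r4 m).
have mE m : measurable (E m) by have [] := EP m.
have mL : measurable (lim_sup_set E).
  apply: bigcapT_measurable => n; apply: bigcup_measurable => j _; exact: mE.
exists (~` lim_sup_set E); split; first exact: measurableC.
  rewrite probability_setC// lim_sup_set_cvg0 ?sube0//.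
  apply: (@le_lt_trans _ _ (\sum_(0 <= m <oo) (0 + (1 / (2 ^ m.+1)%:R)%:E))%E).
    apply: lee_nneseries => [m _ _|m _]; first exact: measure_ge0.
    have [_ h _] := EP m; rewrite add0e (le_trans h)// lee_fin div1r.
    by rewrite lef_pV2 ?posrE ?ltr0n ?expn_gt0// ler_nat leq_pexp2l.
  apply: (le_lt_trans (epsilon_trick _ _ (ler01))) => //.
  by rewrite eseries0// add0e ltry.
have out z : ~ lim_sup_set E z -> exists m, forall j, (m <= j)%N -> ~ E j z.
  move=> nz; apply: contrapT => h; apply: nz => m _; apply: contrapT => h'.
  by apply: h; exists m => j mj Ej; apply: h'; exists j.
move=> x y /out[mx nx] /out[my ny]; apply/dFK0P => e e0.
have [k _ kP] := near_infty_natSinv_lt (PosNum e0).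
pose K := maxn (maxn mx my) k.
have [mxK myK kK] : [/\ mx <= K, my <= K & k <= K]%N.
  by rewrite /K; split; rewrite !leq_max leqnn ?orbT.
have r4e : 4 * r K <= e.
  apply: le_trans (ltW (kP K kK)).
  rewrite /r !expnS mulnA natrM invfM mulrA divff ?mul1r ?pnatr_eq0//.
  by rewrite lef_pV2 ?posrE ?ltr0n ?expn_gt0// ler_nat ltn_expl.
have [_ _ /(_ x y (nx K mxK) (ny K myK))[N hN]] := EP K.
exists N => n /hN hn; apply: (@le_trans _ _ ((1 - 4 * r K) * n%:R)).
  by rewrite ler_wpM2r// lerD2l lerN2.
rewrite (le_trans hn)// ler_nat max_match_le// (le_trans _ r4e)//.
by rewrite ler_peMl ?ltW ?ltr1n.
Qed.

(** For the partition into an invariant set and its complement every name is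
    constant, and words at edit distance less than [1] share a letter, so the
    points whose names are close to [w] all lie on one side. *)
Lemma short_words_ergodic (R : realType) (X : pointedMetricType R) (T : X -> X)
    (mu : probability (borel X) R) : continuous T ->
  short_words T mu -> ergodic_measure T mu.
Proof.
move=> cT S3 A mA TA.
have [A0|/eqP A0] := eqVneq (mu A) 0%E; first by left.
have [A1|/eqP A1] := eqVneq (mu A) 1%E; first by right.
exfalso.
have mAC : measurable (~` A) by exact: measurableC.
have nA0 : A !=set0.
  by apply/set0P/eqP => A00; apply: A0; rewrite A00 measure0.
have nAC0 : ~` A !=set0.
  by apply/set0P/eqP => A00; apply: A1; apply: probability_setC_eq0 => //;
     rewrite A00 measure0.
pose P (i : 'I_2) : set (borel X) := if i == ord0 then A else ~` A.
have partP : measurable_partition P.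
  split; last by move=> i; rewrite /P; case: ifP.
  split.
  - apply/seteqP; split=> // x _; have [Ax|nAx] := pselect (A x).
      by exists ord0.
    by exists ord_max.
  - move=> i j _ _ [x []]; rewrite /P.
    have [->|i0] := eqVneq i ord0; have [->|j0] := eqVneq j ord0 => //= Pi Pj.
    have ord2 (l : 'I_2) : l != ord0 -> l = ord_max.
      by case: l => -[|[|//]] lt2 // _; exact: val_inj.
    by rewrite (ord2 i i0) (ord2 j j0).
  - by move=> i _; rewrite /P; case: ifP.
have TP i n x : P i (iter n T x) <-> P i x.
  have TA' z : A (T z) <-> A z by rewrite -[X in _ <-> X z]TA.
  have TAn z : A (iter n T z) <-> A z.
    by elim: n => [//|n IH]; rewrite iterS TA'.
  by rewrite /P; case: ifP => _ //; split; apply: contra_not => /TAn.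
pose a := fine (mu A).
have aE : mu A = a%:E by rewrite fineK// fin_num_measure.
have a0 : 0 < a.
  rewrite -lte_fin -aE lt_neqAle measure_ge0 andbT eq_sym; exact/eqP.
have a1 : a < 1.
  rewrite -lte_fin -aE lt_neqAle probability_le1 // andbT; exact/eqP.
pose eps := Num.min a (1 - a) / 2.
have eps0 : 0 < eps by rewrite divr_gt0// lt_min a0 subr_gt0.
have eps1 : 2 * eps <= a by rewrite /eps mulrC divfK// ge_min lexx.
have eps2 : 2 * eps <= 1 - a by rewrite /eps mulrC divfK// ge_min lexx orbT.
have [N /(_ N.+1 (ltnSn N))[w [y yw]]] := S3 _ P partP eps eps0.
set W := \bigcup_(_ in _) _ => muW.
have mP i : measurable (P i) by have [_] := partP.
have mW : measurable (W : set (borel X)) by exact: measurable_cells.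
have side x : W x -> exists i, P i x /\ P i y.
  move=> [w' [_]] /=; rewrite /edit_dist match_ratio_lt// => h xw'.
  have : (0 < \max_(m < N.+2 | common_subseq w w' m) m)%N.
    rewrite -(ltr_nat R); apply: le_lt_trans h.
    by rewrite mulr_ge0//; lra.
  move=> /max_common_subseqP[[//|[i j] s]] /andP[_ /= /andP[/and3P[/= iN jN +] _]] _.
  rewrite -[i]/(val (Ordinal iN)) -[j]/(val (Ordinal jN)) word_relE => /eqP ij.
  exists (tnth w (Ordinal iN)); split.
    by rewrite ij; apply/(TP _ (Ordinal jN)); exact: xw'.
  by apply/(TP _ (Ordinal iN)); exact: yw.
have [Ay|nAy] := pselect (A y).
  have : (mu W <= mu A)%E.
    apply: le_measure; rewrite ?inE// => x /side[i].
    by rewrite /P; case: ifP => _ [].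
  by move=> /(le_trans muW); rewrite aE lee_fin; lra.
have : (mu W <= mu (~` A))%E.
  apply: le_measure; rewrite ?inE// => x /side[i].
  by rewrite /P; case: ifP => _ [].
by move=> /(le_trans muW); rewrite probability_setC// aE -EFinB lee_fin; lra.
Qed.

Theorem theorem4p4 (R : realType) (X : pointedMetricType R)
    (hX : compact [set: X]) (T : X -> X) (hT : continuous T)
    (mu : probability (borel X) R) (hmu : invariant_measure T mu) :
  let S1 := (mu \x mu)%E [set p : borel X * borel X | dFK T p.1 p.2 = 0]
            = 1%E in
  let S2 := exists M : set (borel X),
      [/\ measurable M, mu M = 1%E & forall x y, M x -> M y -> dFK T x y = 0] in
  let S3 := forall (k : nat) (P : 'I_k -> set (borel X)),
      measurable_partition P ->
      forall eps : R, 0 < eps ->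
      exists N : nat, forall n : nat, (N < n)%N ->
      exists2 w : n.-tuple 'I_k, join_words T P w &
        ((1 - eps)%:E <=
         mu (\bigcup_(w' in [set w' | join_words T P w' /\
                                      (edit_dist R w w' < eps)%R])
               cell T P w'))%E in
  [/\ S1 <-> S2, S2 <-> S3 & (S1 \/ S2 \/ S3 -> ergodic_measure T mu)].
Proof.
move=> S1 S2 S3.
have h12 : S1 -> S2 by exact: FK_ae_full_set.
have h21 : S2 -> S1 by move=> [M [mM M1 hM]]; exact: FK_full_set_ae mM M1 hM.
have h23 : S2 -> S3 by move=> [M [mM M1 hM]]; exact: full_set_short_words mM M1 hM.
have h32 : S3 -> S2 by exact: short_words_full_set.
have h3 : S3 -> ergodic_measure T mu by exact: short_words_ergodic.
split; [by split|by split|].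
by case=> [/h12/h23/h3|[/h23/h3|/h3]].
Qed.
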